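(* There exists a universal constant $c_0>0$ such that the following holds. Let $\alpha,\beta>0$ with $\alpha+\beta=1$ and $\alpha\in(0,\tfrac12)$, let $\gamma=\sqrt{\alpha/\beta}$, let $n\ge 1$, and let $f:\{-\gamma,\gamma^{-1}\}^n\to\{-1,1\}$ have Walsh–Fourier expansion $f=\sum_{T\subseteq[n]}a_T w_T$. Put $\rho=\big(\sum_{|T|>1}a_T^2\big)^{1/2}$. If $\rho\ln(e/\rho)<c_0\alpha$, then there exists $k\in[n]$ such that \[ \big\|f-(a_\emptyset+a_{\{k\}}w_{\{k\}})\big\|_2\le 2\rho . \]
   Context: The cube $\{-\gamma,\gamma^{-1}\}^n$ is equipped with the product probability measure $\mu_n=\mu^{\otimes n}$, where $\mu=\beta\delta_{-\gamma}+\alpha\delta_{\gamma^{-1}}$. For $g,h:\{-\gamma,\gamma^{-1}\}^n\to\mathbb{R}$, $\langle g,h\rangle=\int gh\,d\mu_n$ and $\|g\|_2=\sqrt{\langle g,g\rangle}$. Here $[n]=\{1,\dots,n\}$, and for $T\subseteq[n]$ and $x=(x_1,\dots,x_n)$, $w_T(x)=\prod_{i\in T}x_i$ with $w_\emptyset\equiv1$; the functions $(w_T)_{T\subseteq[n]}$ form an orthonormal basis of $L_2(\mu_n)$, and the Walsh–Fourier expansion of $f$ is its (unique) expansion in this basis. In particular $w_{\{k\}}(x)=x_k$. *)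

(* Defs.v *)
From HB Require Import structures.
From mathcomp Require Import all_boot all_order all_algebra.
From mathcomp Require Import all_classical all_reals all_analysis.

Set Implicit Arguments.
Unset Strict Implicit.
Unset Printing Implicit Defensive.

Import Order.TTheory GRing.Theory Num.Theory.
Local Open Scope ring_scope.

Section BiasedCube.
Variable R : realType.

Definition two_point (gamma : R) : finType := seq_sub [:: - gamma; gamma^-1].

Definition cube (gamma : R) (n : nat) : finType :=
  {ffun 'I_n -> two_point gamma}.

Definition coord (gamma : R) (n : nat) (x : cube gamma n) (i : 'I_n) : R :=
  ssval (x i).

(* Mass that beta \delta_{-gamma} + alpha \delta_{gamma^-1} gives to {t}. *)
Definition mu1 (alpha beta gamma t : R) : R :=
  beta * (t == - gamma)%:R + alpha * (t == gamma^-1)%:R.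

(* Mass of the singleton {x} under the product measure. *)
Definition mu (alpha beta gamma : R) (n : nat) (x : cube gamma n) : R :=
  \prod_(i < n) mu1 alpha beta gamma (coord x i).

Definition inner (alpha beta gamma : R) (n : nat)
    (g h : cube gamma n -> R) : R :=
  \sum_(x : cube gamma n) g x * h x * mu alpha beta x.

Definition norm2 (alpha beta gamma : R) (n : nat)
    (g : cube gamma n -> R) : R :=
  Num.sqrt (inner alpha beta g g).

Definition walsh (gamma : R) (n : nat) (T : {set 'I_n})
    (x : cube gamma n) : R :=
  \prod_(i in T) coord x i.

Definition walsh_expansion (gamma : R) (n : nat)
    (f : cube gamma n -> R) (a : {set 'I_n} -> R) : Prop :=
  forall x, f x = \sum_(T : {set 'I_n}) a T * walsh T x.

Definition tail_norm (n : nat) (a : {set 'I_n} -> R) : R :=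
  Num.sqrt (\sum_(T : {set 'I_n} | (1 < #|T|)%N) a T ^+ 2).

End BiasedCube.

(* Main.v *)
(** Write [f = S + h] with [S] the affine part of [f], so that [E h^2 = rho^2],
    and only use that [rho < alpha / 16].  A discrete derivative [D_j f] takes
    values in [{-2, 0, 2}] and is within [D_j h] of the constant
    [a_j (gamma + 1 / gamma)].  Since [alpha beta E (D_j h)^2 <= rho^2], a
    coefficient with [|a_j (gamma + 1 / gamma)| <= 1] satisfies [|a_j| <= rho];
    and two indices cannot both violate this, since [f] would then have a large
    mixed derivative [D_i D_j f = D_i D_j h].  So [|a_j| <= rho] for all [j]
    but one, [k].

    For [J] not containing [k], let [L] be the part of [S] on [J], [V = S - L]
    and [d^2 = E L^2].  The sign of [V] predicts [f] up to an error of order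
    [L^4], and [V] is independent of [L], whence [rho^2 >= d^2 - 4 E L^4].  As
    [E L^4 <= 3 d^4 + 2 rho^2 d^2 / alpha], the bound [d^2 <= 4 rho^2] improves
    itself to [d^2 <= 2 rho^2]; adding the indices of [J] one at a time gives
    the latter for [J = [n] \ {k}], and [|f - a_0 - a_k w_k|^2 = rho^2 + d^2]. *)

Require Import Defs.
From HB Require Import structures.
From mathcomp Require Import all_boot all_order all_algebra.
From mathcomp Require Import all_classical all_reals all_analysis.
From mathcomp Require Import ring lra.

Set Implicit Arguments.
Unset Strict Implicit.
Unset Printing Implicit Defensive.

Import Order.TTheory GRing.Theory Num.Theory.
Local Open Scope ring_scope.

Section BiasedCubeTheory.
Variables (R : realType) (alpha beta gamma : R) (n : nat).
Hypotheses (alpha_gt0 : 0 < alpha) (beta_gt0 : 0 < beta).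
Hypothesis alphaDbeta : alpha + beta = 1.
Hypothesis gammaE : gamma = Num.sqrt (alpha / beta).

Local Notation pt := (two_point gamma).
Local Notation Q := (cube gamma n).
Local Notation mu1 := (mu1 alpha beta gamma).
Local Notation mu := (@mu R alpha beta gamma n).
Local Notation coord := (@Defs.coord R gamma n).

(** * Two-point marginals and expectation on the cube *)

Definition expect (g : Q -> R) : R := \sum_x g x * mu x.

Lemma alphaE : alpha = 1 - beta.
Proof. by rewrite -alphaDbeta addrK. Qed.

Lemma gamma_gt0 : 0 < gamma.
Proof. by rewrite gammaE sqrtr_gt0 divr_gt0. Qed.

Lemma sqr_gamma : gamma ^+ 2 = alpha / beta.
Proof. by rewrite gammaE sqr_sqrtr // divr_ge0 // ltW. Qed.

Lemma beta_gammaE : beta * gamma = alpha / gamma.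
Proof.
have g0 := lt0r_neq0 gamma_gt0; have b0 := lt0r_neq0 beta_gt0.
by apply: (mulIf g0); rewrite -mulrA -expr2 sqr_gamma; field; rewrite b0 g0.
Qed.

Fact lo_subproof : - gamma \in [:: - gamma; gamma^-1].
Proof. by rewrite inE eqxx. Qed.

Fact hi_subproof : gamma^-1 \in [:: - gamma; gamma^-1].
Proof. by rewrite !inE eqxx orbT. Qed.

Definition lo : pt := SeqSub lo_subproof.
Definition hi : pt := SeqSub hi_subproof.

Lemma lo_neq_hi : - gamma != gamma^-1.
Proof.
have g0 := gamma_gt0; have gi0 : 0 < gamma^-1 by rewrite invr_gt0.
by rewrite lt_eqF //; lra.
Qed.

Lemma two_pointP (t : pt) : t = lo \/ t = hi.
Proof.
case: t => t tP; have := tP; rewrite !inE => /orP[/eqP|/eqP] E; [left|right];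
  exact/val_inj.
Qed.

Lemma sum_two_point (F : pt -> R) : \sum_t F t = F lo + F hi.
Proof.
rewrite (bigD1 lo) //=; congr (_ + _).
rewrite (big_pred1 hi) // => t /=.
have neq : (lo == hi) = false by apply/negbTE; exact: lo_neq_hi.
by case: (two_pointP t) => ->; rewrite ?eqxx ?neq // eq_sym neq.
Qed.

Lemma mu1_lo : mu1 (ssval lo) = beta.
Proof.
by rewrite /Defs.mu1 /= eqxx (negbTE lo_neq_hi) mulr1 mulr0 addr0.
Qed.

Lemma mu1_hi : mu1 (ssval hi) = alpha.
Proof.
by rewrite /Defs.mu1 /= eqxx eq_sym (negbTE lo_neq_hi) mulr1 mulr0 add0r.
Qed.

Lemma mu1_ge0 (t : R) : 0 <= mu1 t.
Proof. by rewrite addr_ge0 // mulr_ge0 // ltW. Qed.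

Lemma mu_ge0 (x : Q) : 0 <= mu x.
Proof. by apply: prodr_ge0 => i _; exact: mu1_ge0. Qed.

Lemma eq_expect (g h : Q -> R) : g =1 h -> expect g = expect h.
Proof. by move=> gh; apply: eq_bigr => x _; rewrite gh. Qed.

Lemma expectD (g h : Q -> R) :
  expect (fun x => g x + h x) = expect g + expect h.
Proof. by rewrite -big_split; apply: eq_bigr => x _; rewrite mulrDl. Qed.

Lemma expectZ (c : R) (g : Q -> R) : expect (fun x => c * g x) = c * expect g.
Proof. by rewrite mulr_sumr; apply: eq_bigr => x _; rewrite mulrA. Qed.

Lemma expect_sum (I : Type) (s : seq I) (P : pred I) (F : I -> Q -> R) :
  expect (fun x => \sum_(i <- s | P i) F i x)
  = \sum_(i <- s | P i) expect (F i).
Proof.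
by rewrite exchange_big /=; apply: eq_bigr => x _; rewrite mulr_suml.
Qed.

Lemma le_expect (g h : Q -> R) :
  (forall x, g x <= h x) -> expect g <= expect h.
Proof. by move=> gh; apply: ler_sum => x _; rewrite ler_wpM2r // mu_ge0. Qed.

Lemma expect_ge0 (g : Q -> R) : (forall x, 0 <= g x) -> 0 <= expect g.
Proof. by move=> g0; apply: sumr_ge0 => x _; rewrite mulr_ge0 // mu_ge0. Qed.

(** * Resampling one coordinate, independence and moments *)

Definition setc (x : Q) (j : 'I_n) (t : pt) : Q :=
  [ffun i => if i == j then t else x i].

Lemma setcE (x : Q) j t i : setc x j t i = if i == j then t else x i.
Proof. by rewrite ffunE. Qed.

Lemma setc_id (x : Q) j : setc x j (x j) = x.
Proof. by apply/ffunP => i; rewrite setcE; case: eqP => [->|]. Qed.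

Lemma setc_setc (x : Q) j t u : setc (setc x j t) j u = setc x j u.
Proof. by apply/ffunP => i; rewrite !setcE; case: eqP. Qed.

Lemma setcC (x : Q) i j t u :
  i != j -> setc (setc x i t) j u = setc (setc x j u) i t.
Proof.
move=> ij; apply/ffunP => l; rewrite !setcE.
by case: (eqVneq l j) => // ->; rewrite eq_sym (negbTE ij).
Qed.

Lemma coord_setc (x : Q) j t i :
  coord (setc x j t) i = if i == j then ssval t else coord x i.
Proof. by rewrite /coord setcE; case: eqP. Qed.

Lemma muD1 (x : Q) j :
  mu x = mu1 (coord x j) * \prod_(i < n | i != j) mu1 (coord x i).
Proof. by rewrite /Defs.mu (bigD1 j). Qed.

(* The map (x, t) |-> (x with x_j := t, x_j) is an involution that exchanges
   the weight of x_j with that of the fresh sample t. *)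
Lemma expect_resample (j : 'I_n) (g : Q -> R) :
  expect g = expect (fun x => beta * g (setc x j lo) + alpha * g (setc x j hi)).
Proof.
pose M (x : Q) := \prod_(i < n | i != j) mu1 (coord x i).
have MS x t : M (setc x j t) = M x.
  by apply: eq_bigr => i ij; rewrite coord_setc (negbTE ij).
pose F (p : Q * pt) :=
  mu1 (coord p.1 j) * M p.1 * mu1 (ssval p.2) * g (setc p.1 j p.2).
pose s (p : Q * pt) : Q * pt := (setc p.1 j p.2, p.1 j).
have sK : involutive s.
  by case=> x t; rewrite /s /= setc_setc setc_id setcE eqxx.
transitivity (\sum_p F p); last first.
  rewrite -(pair_bigA _ (fun x t => F (x, t))) /=; apply: eq_bigr => x _.
  by rewrite sum_two_point /F /= mu1_lo mu1_hi (muD1 x j) -/(M x); ring.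
rewrite (reindex_inj (inv_inj sK)) /=.
rewrite -(pair_bigA _ (fun x t => F (s (x, t)))) /=; apply: eq_bigr => x _.
rewrite sum_two_point /F /s /= !setc_setc !setc_id !MS !coord_setc eqxx.
rewrite mu1_lo mu1_hi (muD1 x j) -/(M x) -/(coord x j).
rewrite -[LHS]mul1r -alphaDbeta; ring.
Qed.

Lemma expect1 : expect (fun=> 1) = 1.
Proof.
pose G (i : 'I_n) (t : pt) := mu1 (ssval t).
transitivity (\prod_(i < n) \sum_t G i t).
  rewrite bigA_distr_bigA /=; apply: eq_bigr => x _; rewrite mul1r.
  by apply: eq_bigr.
by rewrite big1 // => i _; rewrite sum_two_point /G mu1_lo mu1_hi addrC.
Qed.

Lemma expect_cst (c : R) : expect (fun=> c) = c.
Proof.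
by rewrite -[RHS]mulr1 -[in RHS]expect1 -expectZ; apply: eq_expect => x;
  rewrite mulr1.
Qed.

(** Independence from the coordinate [x_j] in functional form, which combines directly with
    [expect_resample]. *)
Definition indep (j : 'I_n) (g : Q -> R) := forall x t, g (setc x j t) = g x.

Lemma expect_coordX (j : 'I_n) (g : Q -> R) p : indep j g ->
  expect (fun x => g x * coord x j ^+ p)
  = (beta * (- gamma) ^+ p + alpha * gamma^-1 ^+ p) * expect g.
Proof.
move=> gj; rewrite (expect_resample j) -expectZ; apply: eq_expect => x.
by rewrite !gj !coord_setc eqxx /=; ring.
Qed.

Lemma expect_coord (j : 'I_n) (g : Q -> R) : indep j g ->
  expect (fun x => g x * coord x j) = 0.
Proof.
move=> gj; have := expect_coordX 1 gj; rewrite !expr1 => ->.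
by rewrite mulrN beta_gammaE addNr mul0r.
Qed.

Lemma second_moment : beta * (- gamma) ^+ 2 + alpha * gamma^-1 ^+ 2 = 1.
Proof.
rewrite exprVn sqrrN sqr_gamma invf_div -[RHS]alphaDbeta; field.
by rewrite !lt0r_neq0.
Qed.

Lemma expect_coord2 (j : 'I_n) (g : Q -> R) : indep j g ->
  expect (fun x => g x * coord x j ^+ 2) = expect g.
Proof. by move=> gj; rewrite expect_coordX // second_moment mul1r. Qed.

(** The bound is 1/alpha + 1/beta = 1/(alpha beta); the fourth moment beta^2/alpha + alpha^2/beta
    falls short of it by exactly 3. *)
Lemma fourth_moment :
  beta * (- gamma) ^+ 4 + alpha * gamma^-1 ^+ 4 <= alpha^-1 * (1 + alpha / beta).
Proof.
have a0 := lt0r_neq0 alpha_gt0; have b0 := lt0r_neq0 beta_gt0.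
rewrite -[4%N]/(2 * 2)%N !exprM sqrrN exprVn sqr_gamma invf_div.
rewrite -subr_ge0.
have -> : alpha^-1 * (1 + alpha / beta) -
  (beta * (alpha / beta) ^+ 2 + alpha * (beta / alpha) ^+ 2) =
  (1 - beta ^+ 2) / alpha + (1 - alpha ^+ 2) / beta.
  by field; rewrite a0 b0.
have -> : 1 - beta ^+ 2 = alpha * (1 + beta) by rewrite alphaE; ring.
have -> : 1 - alpha ^+ 2 = beta * (1 + alpha) by rewrite alphaE; ring.
by rewrite addr_ge0 // !(mulr_ge0, addr_ge0, invr_ge0) // ltW.
Qed.

(** * Linear forms and their second and fourth moments *)

Definition lin (b : 'I_n -> R) (s : seq 'I_n) (x : Q) : R :=
  \sum_(j <- s) b j * coord x j.

Lemma lin_cons b i s x : lin b (i :: s) x = b i * coord x i + lin b s x.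
Proof. by rewrite /lin big_cons. Qed.

Lemma indep_lin b s j : j \notin s -> indep j (lin b s).
Proof.
move=> js x t; rewrite /lin !big_seq; apply: eq_bigr => i si.
by rewrite coord_setc; case: eqP si js => // -> ->.
Qed.

Lemma lin_setc b s x j t : uniq s -> j \in s ->
  lin b s (setc x j t) = lin b s x + b j * (ssval t - coord x j).
Proof.
elim: s => // i s IHs /= /andP[is_ us]; rewrite inE !lin_cons coord_setc.
case: eqVneq => [-> _|ij /= js].
  by rewrite indep_lin //; ring.
by rewrite IHs //; ring.
Qed.

Lemma indepM j (g h : Q -> R) :
  indep j g -> indep j h -> indep j (fun x => g x * h x).
Proof. by move=> gj hj x t; rewrite gj hj. Qed.

Lemma expect_lin (g : Q -> R) b s : (forall j, j \in s -> indep j g) ->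
  expect (fun x => g x * lin b s x) = 0.
Proof.
move=> gs.
rewrite (eq_expect (h := fun x => \sum_(j <- s) b j * (g x * coord x j))).
  rewrite expect_sum big_seq big1 // => j js.
  by rewrite expectZ expect_coord ?mulr0 //; exact: gs.
by move=> x; rewrite mulr_sumr; apply: eq_bigr => j _; ring.
Qed.

(** The weight [g] will be a function of the rest of the affine part of [f]. Cross terms vanish
    because a coordinate has mean zero given the others. *)
Lemma expect_lin2 (g : Q -> R) b s :
  uniq s -> (forall j, j \in s -> indep j g) ->
  expect (fun x => g x * lin b s x ^+ 2) = (\sum_(j <- s) b j ^+ 2) * expect g.
Proof.
elim: s => [_ _|i s IHs /= /andP[is_ us] gs].
  rewrite big_nil mul0r -[RHS](expect_cst 0); apply: eq_expect => x.
  by rewrite /lin big_nil expr0n mulr0.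
have gi : indep i g by apply: gs; rewrite inE eqxx.
have li := indep_lin b is_.
rewrite (eq_expect (h := fun x => b i ^+ 2 * (g x * coord x i ^+ 2)
  + (2 * b i * (g x * lin b s x * coord x i) + g x * lin b s x ^+ 2))); last first.
  by move=> x; rewrite lin_cons; ring.
rewrite !expectD !expectZ expect_coord2 // expect_coord; last exact: indepM.
rewrite IHs //; last by move=> j js; apply: gs; rewrite inE js orbT.
by rewrite big_cons; ring.
Qed.

(** Expand around the head coordinate. The odd cross terms vanish, as this coordinate and the
    remaining form both have mean zero. The middle term completes the square of the sum, and b_i^4
    times the fourth moment is at most r b_i^2 / (alpha beta). *)
Lemma expect_lin4 (b : 'I_n -> R) (s : seq 'I_n) (r : R) : uniq s -> 0 <= r ->
  (forall j, j \in s -> b j ^+ 2 <= r) ->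
  expect (fun x => lin b s x ^+ 4) <=
    3 * (\sum_(j <- s) b j ^+ 2) ^+ 2
    + alpha^-1 * (1 + alpha / beta) * r * \sum_(j <- s) b j ^+ 2.
Proof.
move=> + r0; elim: s => [_ _|i s IHs /= /andP[is_ us] bs].
  rewrite !big_nil expr0n !mulr0 addr0 -(expect_cst 0).
  by apply: le_expect => x; rewrite /lin big_nil expr0n.
have li := indep_lin b is_.
have bi : b i ^+ 2 <= r by apply: bs; rewrite inE eqxx.
have {}IHs := IHs us (fun j js => bs j (mem_behead (s := i :: s) js)).
rewrite (eq_expect (h := fun x => b i ^+ 4 * coord x i ^+ 4
  + (4 * b i ^+ 3 * (lin b s x * coord x i ^+ 3)
  + (6 * b i ^+ 2 * (lin b s x ^+ 2 * coord x i ^+ 2)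
  + (4 * b i * (lin b s x ^+ 3 * coord x i) + lin b s x ^+ 4))))); last first.
  by move=> x; rewrite lin_cons; ring.
rewrite !expectD !expectZ.
have liX p : indep i (fun x => lin b s x ^+ p) by move=> x t; rewrite li.
have -> : expect (fun x => coord x i ^+ 4)
    = beta * (- gamma) ^+ 4 + alpha * gamma^-1 ^+ 4.
  rewrite -[RHS]mulr1 -[in RHS]expect1 -(@expect_coordX i) //.
  by apply: eq_expect => x; rewrite mul1r.
have -> : expect (fun x => lin b s x ^+ 2 * coord x i ^+ 2)
    = expect (fun x => lin b s x ^+ 2).
  exact: expect_coord2 (liX 2).
have -> : expect (fun x => lin b s x ^+ 3 * coord x i) = 0.
  exact: expect_coord (liX 3).
rewrite (expect_coordX 3 li).
have -> : expect (lin b s) = 0.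
  rewrite -(@expect_lin (fun=> 1) b s) //.
  by apply: eq_expect => x; rewrite mul1r.
have -> : expect (fun x => lin b s x ^+ 2) = \sum_(j <- s) b j ^+ 2.
  rewrite -[RHS]mulr1 -[in RHS]expect1 -expect_lin2 //.
  by apply: eq_expect => x; rewrite mul1r.
rewrite big_cons; have := fourth_moment.
set m := _ + _; set K := _ * _; set D := \sum_(j <- s) _ in IHs *.
move=> mK.
have K0 : 0 <= K by rewrite mulr_ge0 ?invr_ge0 ?addr_ge0 ?divr_ge0 // ltW.
have h1 : b i ^+ 4 * m <= K * r * b i ^+ 2.
  apply: (@le_trans _ _ (b i ^+ 4 * K)).
    by rewrite ler_wpM2l // exprn_even_ge0.
  have -> : b i ^+ 4 * K = K * b i ^+ 2 * b i ^+ 2 by ring.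
  by rewrite ler_wpM2r ?sqr_ge0 // ler_wpM2l.
have h2 : 0 <= b i ^+ 4 by rewrite exprn_even_ge0.
have -> : 3 * (b i ^+ 2 + D) ^+ 2 + K * r * (b i ^+ 2 + D)
  = 3 * b i ^+ 4 + 6 * (b i ^+ 2 * D) + K * r * b i ^+ 2
    + (3 * D ^+ 2 + K * r * D) by ring.
rewrite -/K in IHs; rewrite !mulr0 !add0r; lra.
Qed.

(** * Orthonormality of the Walsh functions and Parseval's identity *)

Lemma walshD1 (T : {set 'I_n}) j (x : Q) : j \in T ->
  walsh T x = walsh (T :\ j)%SET x * coord x j.
Proof. by move=> jT; rewrite /walsh (big_setD1 j) //= mulrC. Qed.

Lemma indep_walsh (T : {set 'I_n}) j :
  j \notin T -> indep j (fun x : Q => walsh T x).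
Proof.
move=> jT x t; apply: eq_bigr => i iT; rewrite coord_setc.
by case: eqP iT jT => // -> ->.
Qed.

Lemma expect_walsh_sqr (T : {set 'I_n}) :
  expect (fun x => walsh T x ^+ 2) = 1.
Proof.
have [m] := ubnP #|T|; elim: m T => // m IHm T.
have [->|[j jT]] := set_0Vmem T; rewrite ltnS => cT.
  rewrite -expect1; apply: eq_expect => x.
  by rewrite /walsh big_set0 expr1n.
rewrite -(IHm (T :\ j)%SET).
  have jD : j \notin (T :\ j)%SET by rewrite !inE eqxx.
  rewrite -(@expect_coord2 j (fun x => walsh (T :\ j)%SET x ^+ 2)).
    by apply: eq_expect => x; rewrite (walshD1 _ jT) exprMn.
  by move=> x t; rewrite (indep_walsh jD).
by move: cT; rewrite (cardsD1 j T) jT.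
Qed.

(** A coordinate lying in exactly one of the two sets factors out and has mean zero. *)
Lemma expect_walsh_orth (T U : {set 'I_n}) : T != U ->
  expect (fun x => walsh T x * walsh U x) = 0.
Proof.
have aux (T' U' : {set 'I_n}) j : j \in T' -> j \notin U' ->
    expect (fun x => walsh T' x * walsh U' x) = 0.
  move=> jT jU; have jD : j \notin (T' :\ j)%SET by rewrite !inE eqxx.
  have := expect_coord (indepM (indep_walsh jD) (indep_walsh jU)).
  move=> <-; apply: eq_expect => x; rewrite (walshD1 _ jT); ring.
rewrite finset.eqEsubset negb_and => /orP[] /fintype.subsetPn[j jA jB].
  exact: aux jA jB.
rewrite -(aux _ _ _ jA jB); apply: eq_expect => x; exact: mulrC.
Qed.

Lemma parseval (P : pred {set 'I_n}) (c : {set 'I_n} -> R) :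
  expect (fun x => (\sum_(T | P T) c T * walsh T x) ^+ 2)
  = \sum_(T | P T) c T ^+ 2.
Proof.
rewrite (eq_expect (h := fun x => \sum_(T | P T) \sum_(U | P U)
    c T * c U * (walsh T x * walsh U x))); last first.
  move=> x; rewrite expr2 mulr_suml; apply: eq_bigr => T _.
  by rewrite mulr_sumr; apply: eq_bigr => U _; ring.
rewrite expect_sum; apply: eq_bigr => T PT; rewrite expect_sum.
rewrite (bigD1 T) //= expectZ big1 => [|U /andP[_ UT]].
  by rewrite addr0 -[RHS]mulr1 -(expect_walsh_sqr T) -expr2.
by rewrite expectZ expect_walsh_orth ?mulr0 // eq_sym.
Qed.

(** * Discrete derivatives *)

Definition diff (j : 'I_n) (g : Q -> R) (x : Q) : R :=
  g (setc x j hi) - g (setc x j lo).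

(* Conditionally on the other coordinates, the left-hand side is the variance
   of g and the right-hand side its second moment. *)
Lemma expect_diff_sqr (j : 'I_n) (g : Q -> R) :
  alpha * beta * expect (fun x => diff j g x ^+ 2)
  <= expect (fun x => g x ^+ 2).
Proof.
rewrite [leRHS](expect_resample j) -expectZ; apply: le_expect => x.
rewrite /diff; set u := g (setc x j lo); set v := g (setc x j hi).
rewrite -subr_ge0; suff -> : beta * u ^+ 2 + alpha * v ^+ 2
  - alpha * beta * (v - u) ^+ 2 = (beta * u + alpha * v) ^+ 2 by exact: sqr_ge0.
by rewrite alphaE; ring.
Qed.

Lemma diff_lin (b : 'I_n -> R) (s : seq 'I_n) j x : uniq s -> j \in s ->
  diff j (lin b s) x = b j * (gamma^-1 + gamma).
Proof. by move=> us js; rewrite /diff !lin_setc //=; ring. Qed.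

(** The gap between the two points is 1/sqrt(alpha beta), so the factor alpha beta in
    [expect_diff_sqr] turns the squared derivative of b_j x_j into b_j^2. *)
Lemma sqr_gammaDV : alpha * beta * (gamma^-1 + gamma) ^+ 2 = 1.
Proof.
have a0 := lt0r_neq0 alpha_gt0; have b0 := lt0r_neq0 beta_gt0.
have g0 := lt0r_neq0 gamma_gt0.
have -> : (gamma^-1 + gamma) ^+ 2 = (gamma ^+ 2)^-1 + gamma ^+ 2 + 2 by field.
rewrite sqr_gamma invf_div.
transitivity ((alpha + beta) ^+ 2); first by field; rewrite a0 b0.
by rewrite alphaDbeta expr1n.
Qed.

Lemma sum_card_le1 (F : {set 'I_n} -> R) :
  \sum_(T : {set 'I_n} | ~~ (1 < #|T|)%N) F T
  = F finset.set0 + \sum_i F [set i]%SET.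
Proof.
rewrite (bigD1 finset.set0) /=; last by rewrite cards0.
congr (_ + _); rewrite -(big_imset _ (in2W set1_inj)) /=.
apply: eq_bigl => T; rewrite -leqNgt -cards_eq0; apply/idP/imsetP.
  case/andP=> T1 T0; have /cards1P[i ->] : #|T| == 1%N by case: #|T| T1 T0 => [|[]].
  by exists i.
by case=> i _ ->; rewrite cards1.
Qed.

(** * Sign-valued functions close to affine: at most one large coefficient *)

Section BooleanFunction.
Variables (f : Q -> R) (a : {set 'I_n} -> R).
Hypothesis alpha_lt : alpha < 1 / 2.
Hypothesis f_sign : forall x, f x = -1 \/ f x = 1.
Hypothesis fE : walsh_expansion f a.

Local Notation b := (fun i => a [set i]%SET).
Local Notation tail2 := (\sum_(T : {set 'I_n} | (1 < #|T|)%N) a T ^+ 2).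
Local Notation S := (fun x => a finset.set0 + lin b (enum 'I_n) x).

Hypothesis tail2_lt : 256 * tail2 < alpha ^+ 2.

Lemma tail2_ge0 : 0 <= tail2.
Proof. by apply: sumr_ge0 => T _; exact: sqr_ge0. Qed.

Lemma expect_sub_affine : expect (fun x => (f x - S x) ^+ 2) = tail2.
Proof.
rewrite -parseval; apply: eq_expect => x; congr (_ ^+ 2).
rewrite fE (bigID (fun T : {set 'I_n} => (1 < #|T|)%N)) /= sum_card_le1.
have -> : walsh finset.set0 x = 1 by rewrite /walsh big_set0.
rewrite mulr1 /lin big_enum /=.
suff -> : \sum_i a [set i]%SET * walsh [set i]%SET x
    = \sum_i a [set i]%SET * coord x i by ring.
by apply: eq_bigr => i _; rewrite /walsh big_set1.
Qed.

Lemma diff_sub_affine j x :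
  diff j (fun y => f y - S y) x = diff j f x - b j * (gamma^-1 + gamma).
Proof.
rewrite -(@diff_lin b (enum 'I_n) j x) ?enum_uniq ?mem_enum //.
by rewrite /diff; ring.
Qed.

(** A number c with |c| <= 1 is at least as far from -2 and 2 as from 0. So the derivative of [f] -
    S is everywhere at least |c| in absolute value, and alpha beta c^2 = b_j^2. *)
Lemma small_coef j : (b j * (gamma^-1 + gamma)) ^+ 2 <= 1 ->
  b j ^+ 2 <= tail2.
Proof.
set c := b j * _ => c1; rewrite -expect_sub_affine.
apply: le_trans (expect_diff_sqr j _).
have -> : b j ^+ 2 = alpha * beta * c ^+ 2.
  by rewrite /c exprMn mulrCA sqr_gammaDV mulr1.
rewrite ler_wpM2l ?mulr_ge0 ?(ltW alpha_gt0) ?(ltW beta_gt0) //.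
rewrite -[leLHS]expect_cst; apply: le_expect => x.
rewrite diff_sub_affine -/c /diff.
by case: (f_sign (setc x j hi)) => ->; case: (f_sign (setc x j lo)) => ->; nra.
Qed.

(* If both coordinates are sensitive at x, then the three values of f at x and
   at its two neighbours force the mixed difference to be nonzero. *)
Lemma mixed_diff i j x : i != j ->
  [\/ diff i f x = 0, diff j f x = 0 | 1 <= diff i (diff j f) x ^+ 2].
Proof.
move=> ij; pose p t u := f (setc (setc x i t) j u).
have ei t : f (setc x i t) = p t (x j).
  by rewrite /p setcC // setc_id.
have ej u : f (setc x j u) = p (x i) u by rewrite /p setc_id.
have pE t u : p t u = -1 \/ p t u = 1 by exact: f_sign.
rewrite /diff !ei !ej -!/(p _ _).
have := pE lo lo; have := pE lo hi; have := pE hi lo; have := pE hi hi.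
case: (two_pointP (x i)) => ->; case: (two_pointP (x j)) => ->;
  case=> ->; case=> ->; case=> ->; case=> ->;
  first [by apply: Or31; ring | by apply: Or32; ring | by apply: Or33; nra].
Qed.

(** For h = [f] - S, at every point one of D_i h, D_j h, D_i D_j h has square at least 1: where D_i
    f or D_j f vanishes the large constant remains, and otherwise the mixed derivative, which S does
    not affect, is large. *)
Lemma large_coef_unique i j : i != j ->
  1 < (b i * (gamma^-1 + gamma)) ^+ 2 -> 1 < (b j * (gamma^-1 + gamma)) ^+ 2 ->
  False.
Proof.
move=> ij; set ci := b i * _; set cj := b j * _ => ci1 cj1.
pose h x := f x - S x.
have Di x : diff i h x = diff i f x - ci by exact: diff_sub_affine.
have Dj x : diff j h x = diff j f x - cj by exact: diff_sub_affine.
have Dij x : diff i (diff j h) x = diff i (diff j f) x.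
  by rewrite /diff -!/(diff j _ _) !Dj; ring.
have h1 : 1 <= expect (fun x => diff i h x ^+ 2)
    + (expect (fun x => diff j h x ^+ 2)
    + expect (fun x => diff i (diff j h) x ^+ 2)).
  rewrite -!expectD -expect1; apply: le_expect => x; rewrite Dij Di Dj.
  have := sqr_ge0 (diff i f x - ci); have := sqr_ge0 (diff j f x - cj).
  have := sqr_ge0 (diff i (diff j f) x).
  by case: (mixed_diff x ij) => [->|->|]; rewrite ?sub0r ?sqrrN; lra.
have := expect_diff_sqr i h; have := expect_diff_sqr j h.
have := expect_diff_sqr i (diff j h).
rewrite expect_sub_affine; have := tail2_lt; have := tail2_ge0.
move: h1; set r := tail2.
set A := expect _; set B := expect _; set C := expect _.
have := alpha_gt0; have := alpha_lt; have := alphaE.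
move=> aE al a0 h1 r0 rlt hC hB hA.
have bg : 1 / 2 < beta by lra.
have b1 : beta < 1 by lra.
have ab0 : 0 < alpha * beta by rewrite mulr_gt0.
have ab1 : alpha * beta <= 1 / 2 by nra.
(* After scaling by (alpha beta)^2 the three terms are at most r/2, r/2 and r, while (alpha beta)^2
   >= alpha^2 / 4. Hence alpha^2 <= 8 r, against 256 r < alpha^2. *)
have ab2 : (alpha * beta) ^+ 2 <= (alpha * beta) ^+ 2 * (A + (B + C)).
  by rewrite ler_peMr // sqr_ge0.
have A0 : 0 <= A by rewrite expect_ge0 // => x; exact: sqr_ge0.
have hA' : (alpha * beta) ^+ 2 * A <= 1 / 2 * r.
  by rewrite expr2 -mulrA ler_pM // ?mulr_ge0 // ltW.
have B0 : 0 <= B by rewrite expect_ge0 // => x; exact: sqr_ge0.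
have hB' : (alpha * beta) ^+ 2 * B <= 1 / 2 * r.
  by rewrite expr2 -mulrA ler_pM // ?mulr_ge0 // ltW.
have hC' : (alpha * beta) ^+ 2 * C <= r.
  rewrite expr2 -mulrA; apply: le_trans hB; rewrite ler_wpM2l //; exact: ltW.
have : alpha ^+ 2 / 4 <= (alpha * beta) ^+ 2.
  rewrite exprMn ler_wpM2l ?sqr_ge0 //; nra.
rewrite !mulrDr in ab2; lra.
Qed.

Lemma exists_dominant : (0 < n)%N ->
  exists k, forall j, j != k -> b j ^+ 2 <= tail2.
Proof.
move=> n0; have [[k kP]|no] :=
    pselect (exists k, 1 < (b k * (gamma^-1 + gamma)) ^+ 2).
  exists k => j jk; apply: small_coef; rewrite leNgt; apply/negP => jP.
  exact: large_coef_unique jk jP kP.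
(* No coefficient is large, so any index serves as [k]. *)
exists (Ordinal n0) => j _; apply: small_coef; rewrite leNgt.
by apply/negP => jP; apply: no; exists j.
Qed.

(** * Bootstrapping the weight of the small coefficients *)

(** If F = s, the two sides differ by (V - s)^2 + 4 L^4. If F = -s, they differ by (V + s)^2 + 4 s L
    + 4 L^4, where (V + s)^2 >= 9/4 and 4 L^4 + 4 s L + 2 is a sum of two squares. *)
Lemma sign_dist_ge (F s V L : R) : F = -1 \/ F = 1 -> s = -1 \/ s = 1 ->
  1 / 2 <= s * V -> 2 * (V - s) * L + L ^+ 2 - 4 * L ^+ 4 <= (F - (V + L)) ^+ 2.
Proof.
have L4 : 0 <= L ^+ 4 by rewrite exprn_even_ge0.
have e1 : 4 * L ^+ 4 + 4 * L + 2 = (2 * L ^+ 2 - 1) ^+ 2 + (2 * L + 1) ^+ 2.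
  by ring.
have e2 : 4 * L ^+ 4 - 4 * L + 2 = (2 * L ^+ 2 - 1) ^+ 2 + (2 * L - 1) ^+ 2.
  by ring.
have q1 := sqr_ge0 (2 * L ^+ 2 - 1); have q2 := sqr_ge0 (2 * L + 1).
have q3 := sqr_ge0 (2 * L - 1).
have q4 := sqr_ge0 (V - 1); have q5 := sqr_ge0 (V + 1).
by case=> ->; case=> -> sV; rewrite !expr2 in q4 q5 *; nra.
Qed.

(** Here |F - V| >= 1/2, and (u - L)^2 >= u^2 / 2 - L^2 for every u. *)
Lemma sign_dist_ge_eighth (F V L : R) : F = -1 \/ F = 1 ->
  `|V| < 1 / 2 -> 1 / 8 - L ^+ 2 <= (F - (V + L)) ^+ 2.
Proof.
move=> FE; rewrite ltr_norml => /andP[V1 V2].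
have q1 := sqr_ge0 (F - V - 2 * L).
have q2 : 1 / 4 <= (F - V) ^+ 2 by case: FE => ->; nra.
have -> : (F - (V + L)) ^+ 2
  = (F - V - 2 * L) ^+ 2 / 2 + (F - V) ^+ 2 / 2 - L ^+ 2 by field.
lra.
Qed.

(* Writing S = V + L with L the part on s, the sign of V predicts f up to an
   error of order L^4, and V is independent of L. *)
Lemma bootstrap (s : seq 'I_n) : uniq s ->
  (forall j, j \in s -> b j ^+ 2 <= tail2) ->
  \sum_(j <- s) b j ^+ 2 <= 4 * tail2 -> \sum_(j <- s) b j ^+ 2 <= 2 * tail2.
Proof.
move=> us bs; set D := \sum_(j <- s) _; set r := tail2 in bs *.
have r0 : 0 <= r := tail2_ge0; have rlt : 256 * r < alpha ^+ 2 := tail2_lt.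
pose V x := S x - lin b s x.
have indV j : j \in s -> indep j V.
  move=> js x t; rewrite /V !(lin_setc _ _ _ _ js) // lin_setc ?enum_uniq ?mem_enum //.
  ring.
pose A (v : R) : R := (1 / 2 <= `|v|)%R%:R.
pose G (v : R) : R := A v * (v - (if 0 <= v then 1 else -1)).
have indc (phi : R -> R) j : j \in s -> indep j (fun x => phi (V x)).
  by move=> js x t; rewrite (indV j js).
have A1 x : A (V x) <= 1 by rewrite /A lern1 leq_b1.
(* One inequality for both cases, selected by the indicator [A]. The term linear in [lin b s x] has
   a factor independent of [s], so it averages to zero. *)
have key x : 2 * (G (V x) * lin b s x) + ((2 * A (V x) - 1) * lin b s x ^+ 2
    + (1 / 8 * (1 - A (V x)) + - 4 * lin b s x ^+ 4)) <= (f x - S x) ^+ 2.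
  have -> : S x = V x + lin b s x by rewrite /V subrK.
  rewrite /G /A; case: (leP (1 / 2) `|V x|) => V2.
    apply: le_trans (@sign_dist_ge _ (if 0 <= V x then 1 else -1) _ _ (f_sign x) _ _).
    - by rewrite mulr1n; set c := V x - _; lra.
    - by case: ifP; [right|left].
    - move: V2; case: (leP 0 (V x)) => V0.
        by rewrite (ger0_norm V0); lra.
      by rewrite (ltr0_norm V0); lra.
  apply: le_trans (sign_dist_ge_eighth _ (f_sign x) V2).
  have : 0 <= lin b s x ^+ 4 by rewrite exprn_even_ge0.
  by rewrite mulr0n; lra.
have := le_expect key; rewrite !expectD !expectZ expect_sub_affine -/r.
rewrite expect_lin //; last by move=> j; exact: indc.
rewrite (expect_lin2 (g := fun x => 2 * A (V x) - 1)) //; last first.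
  by move=> j; exact: (indc (fun v => 2 * A v - 1)).
pose p := expect (fun x => A (V x)).
have -> : expect (fun x => 2 * A (V x) - 1) = 2 * p - 1.
  by rewrite expectD expectZ expect_cst.
have -> : expect (fun x => 1 - A (V x)) = 1 - p.
  rewrite expectD expect1 -mulN1r -expectZ; congr (_ + _).
  by apply: eq_expect => x; rewrite mulN1r.
have p1 : p <= 1 by rewrite -[leRHS]expect1; apply: le_expect => x; exact: A1.
have := expect_lin4 us r0 bs; rewrite -/D.
set E4 := expect _; move=> hE h D4.
have D0 : 0 <= D by apply: sumr_ge0 => j _; exact: sqr_ge0.
have a0 := alpha_gt0; have al := alpha_lt; have aE := alphaE.
have a2 : alpha ^+ 2 <= 1 / 4 by rewrite expr2; nra.
(* Since alpha / beta <= 1, the factor is at most 2 r / alpha, which is below alpha / 128. *)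
have K2 : alpha^-1 * (1 + alpha / beta) * r * D <= 1 / 128 * D.
  rewrite ler_wpM2r //.
  have -> : alpha^-1 * (1 + alpha / beta) * r = r * (1 + alpha / beta) / alpha.
    by ring.
  rewrite ler_pdivrMr //.
  have ab : alpha / beta <= 1 by rewrite ler_pdivrMr // mul1r; lra.
  apply: (@le_trans _ _ (r * 2)); first by rewrite ler_wpM2l //; lra.
  by rewrite expr2 in rlt; nra.
have D2 : D ^+ 2 <= 1 / 256 * D by rewrite expr2 ler_wpM2r //; lra.
(* As D <= 1/256, the points where V is small contribute enough to restore the full D. This leaves r
   >= D - 4 [E4] with 4 [E4] <= (12/256 + 4/128) D, well within D <= 2 r. *)
have : 0 <= (1 - p) * (1 / 8 - 2 * D) by rewrite mulr_ge0 // subr_ge0; lra.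
have -> : (1 - p) * (1 / 8 - 2 * D)
  = D * (2 * p - 1) + 1 / 8 * (1 - p) - D by ring.
lra.
Qed.

(** A new index raises the sum from at most 2 to at most 3 times the tail, which stays within the
    factor 4 that [bootstrap] tolerates and brings back to 2. *)
Lemma sum_coef_sqr (s : seq 'I_n) : uniq s ->
  (forall j, j \in s -> b j ^+ 2 <= tail2) ->
  \sum_(j <- s) b j ^+ 2 <= 2 * tail2.
Proof.
elim: s => [_ _|i s IHs us bs]; first by rewrite big_nil mulr_ge0 ?tail2_ge0.
apply: (bootstrap us bs); rewrite big_cons.
have /andP[_ us'] := us.
have := IHs us' (fun j js => bs j (mem_behead (s := i :: s) js)).
by have := bs i (mem_head i s); have := tail2_ge0; lra.
Qed.

Lemma expect_sub_dictator k :
  (forall j, j != k -> b j ^+ 2 <= tail2) ->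
  expect (fun x => (f x - (a finset.set0 + b k * walsh [set k]%SET x)) ^+ 2)
  <= 3 * tail2.
Proof.
move=> kP.
have k0 : [set k]%SET != finset.set0 by rewrite -cards_eq0 cards1.
pose P (T : {set 'I_n}) := (T != finset.set0) && (T != [set k]%SET).
rewrite (eq_expect (h := fun x => (\sum_(T | P T) a T * walsh T x) ^+ 2)).
  rewrite parseval.
  (* The total weight is split in two ways; comparing them leaves the tail plus the squares of the
     singleton coefficients other than that of [k]. *)
  have : \sum_T a T ^+ 2
      = a finset.set0 ^+ 2 + (b k ^+ 2 + \sum_(T | P T) a T ^+ 2).
    by rewrite (bigD1 finset.set0) //= (bigD1 [set k]%SET).
  rewrite (bigID (fun T : {set 'I_n} => (1 < #|T|)%N)) /= sum_card_le1.
  rewrite (bigD1 k) //=.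
  have : \sum_(i | i != k) b i ^+ 2 <= 2 * tail2.
    rewrite -big_enum; apply: sum_coef_sqr; first exact: enum_uniq.
    by move=> j; rewrite mem_enum => /kP.
  by lra.
move=> x; rewrite fE (bigD1 finset.set0) //= (bigD1 [set k]%SET) //=.
have -> : walsh finset.set0 x = 1 by rewrite /walsh big_set0.
by rewrite -/(P _); congr (_ ^+ 2); ring.
Qed.

(** This serves to bound rho by 1, whence ln(e / rho) >= 1. *)
Lemma sum_walsh_coef_sqr : \sum_T a T ^+ 2 = 1.
Proof.
rewrite -parseval -expect1; apply: eq_expect => x.
by rewrite -fE; case: (f_sign x) => ->; rewrite ?sqrrN expr1n.
Qed.

End BooleanFunction.
End BiasedCubeTheory.

(** * From the logarithmic smallness condition to the dictator approximation *)

Theorem theorem2 (R : realType) :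
  exists c0 : R, 0 < c0 /\
  forall (alpha beta gamma : R),
    0 < alpha -> 0 < beta -> alpha + beta = 1 -> alpha < 1 / 2 ->
    gamma = Num.sqrt (alpha / beta) ->
  forall (n : nat), (1 <= n)%N ->
  forall (f : cube gamma n -> R) (a : {set 'I_n} -> R),
    (forall x, f x = -1 \/ f x = 1) ->
    walsh_expansion f a ->
  forall rho : R, rho = tail_norm a ->
    rho * ln (expR 1 / rho) < c0 * alpha ->
  exists k : 'I_n,
    norm2 alpha beta
      (fun x => f x - (a finset.set0 + a [set k]%SET * walsh [set k]%SET x))
      <= 2 * rho.
Proof.
(* The value 1/16 makes rho < c_0 alpha square to 256 rho^2 < alpha^2. *)
exists (1 / 16); split; first lra.
move=> alpha beta gamma a0 b0 ab al gE n n0 f a fs fE rho rhoE rho_lt.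
pose tail2 : R := \sum_(T : {set 'I_n} | (1 < #|T|)%N) a T ^+ 2.
have t0 : 0 <= tail2 by apply: sumr_ge0 => T _; exact: sqr_ge0.
have rho0 : 0 <= rho by rewrite rhoE sqrtr_ge0.
have rho2 : rho ^+ 2 = tail2 by rewrite rhoE sqr_sqrtr.
have rho1 : rho <= 1.
  rewrite -(@ler_pXn2r _ 2) ?nnegrE // rho2 expr1n.
  rewrite -(sum_walsh_coef_sqr a0 b0 ab gE fs fE).
  rewrite [leRHS](bigID (fun T : {set 'I_n} => (1 < #|T|)%N)) /= lerDl.
  by apply: sumr_ge0 => T _; exact: sqr_ge0.
(* The logarithm is at least 1 because 0 < rho <= 1; for rho = 0 both sides of the comparison
   vanish. *)
have rho_lt' : rho < 1 / 16 * alpha.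
  apply: le_lt_trans rho_lt; have [->|rho_neq0] := eqVneq rho 0.
    by rewrite mul0r.
  have rho_gt0 : 0 < rho by rewrite lt0r rho_neq0.
  rewrite ler_peMr // -[leLHS]expRK ler_ln ?posrE ?expR_gt0 ?divr_gt0 ?expR_gt0 //.
  by rewrite ler_pdivlMr // ler_piMr // ltW // expR_gt0.
have tail_lt : 256 * tail2 < alpha ^+ 2 by rewrite -rho2 !expr2; nra.
have [k kP] := exists_dominant a0 b0 ab gE al fs fE tail_lt n0.
exists k; have := expect_sub_dictator a0 b0 ab gE al fs fE tail_lt kP.
rewrite -/tail2 /norm2 => h.
rewrite -(@ler_pXn2r _ 2) ?nnegrE ?sqrtr_ge0 ?mulr_ge0 //.
rewrite sqr_sqrtr; last first.
  by apply: sumr_ge0 => x _; rewrite mulr_ge0 ?mu_ge0 // -expr2 sqr_ge0.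
rewrite exprMn rho2; apply: (@le_trans _ _ (3 * tail2)); last by lra.
exact: h.
Qed.
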